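(* Let $X$ be a Banach space and $1\le p<2$. If $X$ is of weak Haar type $p$, then $X$ is of Haar type $r$ for every $r<p$ (with $1\le r$).
   Context: Dyadic intervals: for $k\ge 0$ and integers $j$, $\Delta_k^{(j)}:=[\frac{j-1}{2^k},\frac{j}{2^k})$. Haar functions: for $k=1,2,\dots$ and integers $j$, $\chi_k^{(j)}(t)=+2^{(k-1)/2}$ if $t\in\Delta_k^{(2j-1)}$, $-2^{(k-1)/2}$ if $t\in\Delta_k^{(2j)}$, and $0$ otherwise ($t\in[0,1)$). For an $X$-valued function $f$ on $[0,1)$, $\|f|L_q\|$ denotes its Bochner $L_q([0,1),X)$ norm. For $1\le r\le 2$, $X$ is of Haar type $r$ if there is $c\ge0$ such that $$\Big\|\sum_{k=1}^n\sum_{j=1}^{2^{k-1}}x_k^{(j)}\chi_k^{(j)}\Big|L_r\Big\|\le c\Big(\sum_{k=1}^n\Big\|\sum_{j=1}^{2^{k-1}}x_k^{(j)}\chi_k^{(j)}\Big|L_r\Big\|^r\Big)^{1/r}$$ for all $n\in\mathbb N$ and all $x_k^{(j)}\in X$. For $1\le p<2$, $X$ is of weak Haar type $p$ if there is $c\ge0$ such that $$\Big\|\sum_{k=1}^n\sum_{j=1}^{2^{k-1}}x_k^{(j)}\chi_k^{(j)}\Big|L_2\Big\|\le c\,n^{1/p-1/2}\Big(\sum_{k=1}^n\Big\|\sum_{j=1}^{2^{k-1}}x_k^{(j)}\chi_k^{(j)}\Big|L_2\Big\|^2\Big)^{1/2}$$ for all $n\in\mathbb N$ and all $x_k^{(j)}\in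 X$. *)

(* Defs.v *)
From HB Require Import structures.
From mathcomp Require Import all_boot all_order all_algebra.
From mathcomp Require Import all_classical all_reals all_analysis.
Set Implicit Arguments. Unset Strict Implicit. Unset Printing Implicit Defensive.
Import Order.TTheory GRing.Theory Num.Theory.
Import numFieldNormedType.Exports.
Local Open Scope classical_set_scope.
Local Open Scope ring_scope.

Section Haar.
Variables (R : realType).

Definition dyadic (k i : nat) : set R :=
  `[((i%:R - 1) / 2 ^+ k), (i%:R / 2 ^+ k)[%classic.

Definition haar (k j : nat) (t : R) : R :=
  if `[< dyadic k (2 * j - 1) t >] then Num.sqrt (2 ^+ (k - 1))
  else if `[< dyadic k (2 * j) t >] then - Num.sqrt (2 ^+ (k - 1))
  else 0.

Variable (X : normedModType R).

Definition Lqnorm (q : R) (f : R -> X) : R :=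
  (fine (\int[lebesgue_measure]_(t in `[0%R, 1%R[%classic)
            ((`|f t| `^ q)%:E))) `^ q^-1.

Definition haar_block (x : nat -> nat -> X) (k : nat) (t : R) : X :=
  \sum_(1 <= j < (2 ^ (k - 1)).+1) haar k j t *: x k j.

Definition haar_sum (x : nat -> nat -> X) (n : nat) (t : R) : X :=
  \sum_(1 <= k < n.+1) haar_block x k t.

Definition haar_type (r : R) : Prop :=
  exists c : R, 0 <= c /\
    forall (n : nat) (x : nat -> nat -> X), (0 < n)%N ->
      Lqnorm r (haar_sum x n) <=
      c * (\sum_(1 <= k < n.+1) Lqnorm r (haar_block x k) `^ r) `^ r^-1.

Definition weak_haar_type (p : R) : Prop :=
  exists c : R, 0 <= c /\
    forall (n : nat) (x : nat -> nat -> X), (0 < n)%N ->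
      Lqnorm 2 (haar_sum x n) <=
      c * (n%:R `^ (p^-1 - 2^-1)) *
      (\sum_(1 <= k < n.+1) Lqnorm 2 (haar_block x k) `^ 2) `^ 2^-1.

End Haar.

(* Main.v *)
Require Import Defs.
From HB Require Import structures.
From mathcomp Require Import all_boot all_order all_algebra.
From mathcomp Require Import all_classical all_reals all_analysis.
From mathcomp Require Import measurable_realfun ring lra zify.
Import Order.TTheory GRing.Theory Num.Theory.
Import numFieldNormedType.Exports.
Local Open Scope ring_scope.
Set Implicit Arguments.
Unset Strict Implicit.
Unset Printing Implicit Defensive.

(** A Haar sum is a dyadic martingale f with differences d_k whose norms are
    predictable. Fix r < q < p and put S = sum_k |d_k|^q.
    - The weak type inequality only sees the maximal number n of nonzero
      differences along a path: where a difference vanishes, replace both halves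
      by the one that is worse for E|f|^2 - K sum_k E|d_k|^2.
    - If S <= lam^q, at most 2^((i+1)q) differences on a path have norm in
      ]lam 2^-(i+1), lam 2^-i]. The weak type inequality at each of these scales
      gives a geometric series because q < p, so E|f|^2 <= K lam^(2-q) E S.
    - Stopping f before S exceeds lam^q yields
      P(|f| > lam) <= (1 + K) E min(S / lam^q, 1).
    - Summing lam^r times this over lam = lam0 2^(m/q) gives
      E|f|^r <= D E S^(r/q) <= D sum_k E|d_k|^r, as r/q < 1. *)

(** * Finite binary trees as dyadic martingales *)

Section Tree.
Variables (R : realType) (X : normedModType R).
Implicit Types (a b x : X) (q s : R).

(* From [Node x l r] the martingale moves by [x] and continues along [l], or by
   [- x] and continues along [r], with probability 1/2 each. *)
Inductive tree := Leaf | Node of X & tree & tree.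
Implicit Types t l r : tree.

(** [mom] is E|f|^q for the martingale f started at [a]. With S the sum of the |d_k|^q, [var] is E S
    and [maxvar] is the supremum of S over all paths. *)
Fixpoint mom q a t : R :=
  if t is Node x l r then (mom q (a + x) l + mom q (a - x) r) / 2
  else `|a| `^ q.

Fixpoint var q t : R :=
  if t is Node x l r then `|x| `^ q + (var q l + var q r) / 2 else 0.

Fixpoint maxvar q t : R :=
  if t is Node x l r then `|x| `^ q + Num.max (maxvar q l) (maxvar q r) else 0.

Fixpoint height t : nat :=
  if t is Node _ l r then (maxn (height l) (height r)).+1 else 0%N.

Fixpoint nnz t : nat :=
  if t is Node x l r then ((x != 0%R) + maxn (nnz l) (nnz r))%N else 0%N.

(** Rejected labels become 0 and stay in place, so that filtered martingales share one shape and can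
    be added node by node. *)
Fixpoint filt (P : X -> bool) t : tree :=
  if t is Node x l r then Node (if P x then x else 0) (filt P l) (filt P r)
  else Leaf.

Lemma mom_ge0 q a t : 0 <= mom q a t.
Proof.
elim: t a => [|x l IHl r IHr] a /=; first exact: powR_ge0.
by rewrite divr_ge0 ?addr_ge0.
Qed.

Lemma var_ge0 q t : 0 <= var q t.
Proof.
elim: t => //= x l IHl r IHr.
by rewrite addr_ge0 ?powR_ge0 // divr_ge0 ?addr_ge0.
Qed.

Lemma maxvar_ge0 q t : 0 <= maxvar q t.
Proof.
elim: t => //= x l IHl r IHr.
by rewrite addr_ge0 ?powR_ge0 // le_max IHl.
Qed.

(** At a zero label both subtrees start from the same point, so the functional is the mean of its
    values on them. Keeping only the subtree with the larger value removes the node and does not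
    decrease the functional. *)
Lemma compress (K : R) n t a : (nnz t <= n)%N ->
  exists2 t', (height t' <= n)%N &
    mom 2 a t - K * var 2 t <= mom 2 a t' - K * var 2 t'.
Proof.
elim: t n a => [|x l IHl r IHr] n a /=; first by exists Leaf.
have [->|x0] := eqVneq x 0 => /=.
  rewrite add0n geq_max => /andP[hl hr].
  have [l' hl' Hl] := IHl _ a hl; have [r' hr' Hr] := IHr _ a hr.
  rewrite addr0 subr0 normr0 powR0 // add0r.
  have [le|/ltW le] := lerP (mom 2 a l' - K * var 2 l') (mom 2 a r' - K * var 2 r').
    by exists r' => //; lra.
  by exists l' => //; lra.
case: n => [|n]; rewrite add1n // ltnS geq_max => /andP[hl hr].
have [l' hl' Hl] := IHl _ (a + x) hl; have [r' hr' Hr] := IHr _ (a - x) hr.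
by exists (Node x l' r') => /=; [rewrite ltnS geq_max hl'|lra].
Qed.

(** As P and Q are disjoint, the martingale filtered by [PQ] is the sum of the other two. The
    estimate then only has to hold at the leaves, where it is a weighted convexity inequality for
    the square. *)
Lemma mom_filtU (P Q PQ : X -> bool) (th : R) a b t : 0 < th < 1 ->
  (forall x, PQ x = P x || Q x) -> (forall x, ~~ (P x && Q x)) ->
  mom 2 (a + b) (filt PQ t) <=
    mom 2 a (filt P t) / (1 - th) + mom 2 b (filt Q t) / th.
Proof.
move=> /andP[th0 th1] hPQ dPQ; elim: t a b => [|x l IHl r IHr] a b /=.
  rewrite !powR_mulrn //.
  have h : `|a + b| ^+ 2 <= (`|a| + `|b|) ^+ 2.
    by rewrite lerXn2r ?nnegrE ?addr_ge0 // ler_normD.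
  apply: (le_trans h); set u := `|a|; set v := `|b|.
  have th1' : 0 < 1 - th by lra.
  rewrite -subr_ge0.
  (* The difference of the two sides is a perfect square up to a positive factor. *)
  have -> : u ^+ 2 / (1 - th) + v ^+ 2 / th - (u + v) ^+ 2
      = (th * u - (1 - th) * v) ^+ 2 / (th * (1 - th)).
    by field; rewrite !gt_eqF.
  by rewrite divr_ge0 ?sqr_ge0 // mulr_ge0 // ltW.
rewrite hPQ; set p := if P x then x else 0; set c := if Q x then x else 0.
have -> : (if P x || Q x then x else 0) = p + c.
  rewrite /p /c; have := dPQ x.
  by case: (P x); case: (Q x); rewrite /= ?addr0 ?add0r.
have -> : a + b + (p + c) = (a + p) + (b + c) by rewrite addrACA.
have -> : a + b - (p + c) = (a - p) + (b - c) by rewrite opprD addrACA.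
have := IHl (a + p) (b + c); have := IHr (a - p) (b - c).
move: (mom _ _ _) (mom _ _ _) (mom _ _ _) (mom _ _ _) (mom _ _ _) (mom _ _ _).
by move=> *; lra.
Qed.

Lemma var_filt q (P : X -> bool) (e : R) t : 0 < q -> q <= 2 -> 0 < e ->
  (forall x, P x -> `|x| <= e) ->
  var 2 (filt P t) <= e `^ (2 - q) * var q t.
Proof.
move=> q0 q2 e0 Pe; elim: t => [|x l IHl r IHr] /=; first by rewrite mulr0.
have h : `|if P x then x else 0| `^ 2 <= e `^ (2 - q) * `|x| `^ q.
  case: ifPn => Px; last by rewrite normr0 powR0 // mulr_ge0 ?powR_ge0.
  have [->|x0] := eqVneq x 0; first by rewrite normr0 !powR0 ?gt_eqF // mulr0.
  rewrite [X in _ `^ X](_ : 2 = (2 - q) + q); last by ring.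
  rewrite powRD; last by rewrite subrK pnatr_eq0 /=.
  rewrite ler_wpM2r ?powR_ge0 // ge0_ler_powR ?nnegrE ?subr_ge0 ?Pe //.
  exact: ltW.
by lra.
Qed.

(** Markov's inequality along each path: a retained label adds at least d^q to the path sum. *)
Lemma nnz_filt q (P : X -> bool) (d : R) t : 0 <= q -> 0 <= d ->
  (forall x, P x -> d <= `|x|) ->
  (nnz (filt P t))%:R * d `^ q <= maxvar q t.
Proof.
move=> q0 d0 Pd; elim: t => [|x l IHl r IHr] /=; first by rewrite mul0r.
rewrite natrD mulrDl lerD //.
  case: ifPn => Px; last by rewrite eqxx mul0r powR_ge0.
  case: eqP => _; rewrite ?mul0r ?powR_ge0 // mul1r.
  by rewrite ge0_ler_powR ?nnegrE ?Pd.
rewrite le_max; case: (leqP (nnz (filt P l)) (nnz (filt P r))) => _.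
  by rewrite IHr orbT.
by rewrite IHl.
Qed.

(* Only finitely many labels occur in [t]. *)
Lemma filt_small (u : R) t : 0 < u -> exists m : nat,
  forall a, mom 2 a (filt (fun x => `|x| <= u / 2 ^+ m) t) = `|a| `^ 2.
Proof.
move=> u0.
have cv (x : X) : exists m : nat, forall k, (m <= k)%N ->
    (`|x| <= u / 2 ^+ k) -> x = 0.
  have [->|x0] := eqVneq x 0; first by exists 0%N.
  exists (Num.bound (u / `|x|)) => k mk; rewrite leNgt.
  rewrite ltr_pdivrMr ?exprn_gt0 // -ltr_pdivrMl ?normr_gt0 // mulrC.
  have h : u / `|x| < (Num.bound (u / `|x|))%:R.
    by apply: archi_boundP; rewrite divr_ge0 // ltW.
  rewrite (lt_trans h) //= -natrX ltr_nat.
  by apply: leq_ltn_trans mk _; rewrite ltn_expl.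
(* Asking for all k >= m lets the thresholds of the subtrees be merged by a maximum. *)
suff [m Hm] : exists m : nat, forall k, (m <= k)%N ->
    forall a, mom 2 a (filt (fun x => `|x| <= u / 2 ^+ k) t) = `|a| `^ 2.
  by exists m; apply: Hm.
elim: t => [|x l [ml IHl] r [mr IHr]]; first by exists 0%N.
have [mx Hx] := cv x; exists (maxn mx (maxn ml mr)) => k.
rewrite !geq_max => /and3P[kx kl kr] a /=.
have -> : (if `|x| <= u / 2 ^+ k then x else 0) = 0 by case: ifP => // /Hx ->.
by rewrite addr0 subr0 IHl // IHr // mulrDl -splitr.
Qed.

End Tree.

(** * The L_2 bound for martingales with bounded S *)

Section Weak.
Variables (R : realType) (X : normedModType R).
Implicit Types (a b x : X) (q s : R) (t l r : tree X).

(** The weak type inequality after squaring: [beta] stands for 2 (1/p - 1/2). *)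
Definition tree_weak_type (C beta : R) := forall n t, (0 < n)%N ->
  (height t <= n)%N -> mom 2 0 t <= C * n%:R `^ beta * var 2 t.

(** With K the weak type constant for n, the functional of [compress] is nonpositive on trees of
    height at most n, hence also on the tree before compression. *)
Lemma weak_nnz (C beta : R) : tree_weak_type C beta -> forall n t, (0 < n)%N ->
  (nnz t <= n)%N -> mom 2 0 t <= C * n%:R `^ beta * var 2 t.
Proof.
move=> wk n t n0 tn.
have [t' ht' le] := compress (C * n%:R `^ beta) 0 tn.
by have := wk n t' n0 ht'; lra.
Qed.

Lemma filt_id q M (P : X -> bool) t : maxvar q t <= M ->
  (forall x, `|x| `^ q <= M -> P x) -> filt P t = t.
Proof.
move=> + MP; elim: t => //= x l IHl r IHr h.
have x0 := powR_ge0 `|x| q.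
have hm : Num.max (maxvar q l) (maxvar q r) <= M by lra.
have h0 : 0 <= Num.max (maxvar q l) (maxvar q r) by rewrite le_max maxvar_ge0.
move: hm; rewrite ge_max => /andP[hl hr].
by rewrite IHl // IHr // MP //; lra.
Qed.

(** By [nnz_filt] with d = e / 2, a path has at most (2 lam / e)^q nonzero labels in the band.
    [weak_nnz] applies with that number, and [var_filt] passes from exponent 2 to q. *)
Lemma mom_band (C beta q lam e : R) (P : X -> bool) t :
  tree_weak_type C beta -> 0 <= C -> 0 <= beta -> 0 < q -> q <= 2 ->
  0 < e -> e <= lam -> maxvar q t <= lam `^ q ->
  (forall x, P x -> e / 2 <= `|x| <= e) ->
  mom 2 0 (filt P t) <=
    C * (2 * lam / e) `^ (q * beta) * (e `^ (2 - q) * var q t).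
Proof.
move=> wk C0 b0 q0 q2 e0 elam tlam Pe.
(* [weak_nnz] wants n > 0; the maximum with 1 is harmless since 2 lam / e >= 1. *)
set n := maxn 1 (nnz (filt P t)).
have le1 : 1 <= 2 * lam / e by rewrite ler_pdivlMr //; lra.
have nle : n%:R <= (2 * lam / e) `^ q.
  rewrite /n; case: leqP => h.
    have e20 : 0 < e / 2 by rewrite divr_gt0.
    rewrite -(ler_pM2r (powR_gt0 q e20)) -powRM ?(le_trans ler01 le1) ?(ltW e20) //.
    have -> : 2 * lam / e * (e / 2) = lam by field; rewrite gt_eqF.
    by apply: le_trans tlam; apply: nnz_filt => [||x /Pe/andP[]//]; exact: ltW.
  rewrite (_ : 1%:R = 1 `^ q); last by rewrite powR1.
  by rewrite ge0_ler_powR ?nnegrE ?ler01 ?(le_trans ler01 le1) // ltW.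
have n0 : (0 < n)%N by rewrite /n leq_max.
apply: (le_trans (weak_nnz wk n0 (leq_maxr _ _))).
apply: ler_pM; rewrite ?mulr_ge0 ?powR_ge0 ?var_ge0 //.
  rewrite ler_wpM2l // powRrM ge0_ler_powR ?nnegrE ?powR_ge0 //.
by apply: var_filt => // x /Pe/andP[].
Qed.

Lemma mom_le_var (C beta q : R) :
  tree_weak_type C beta -> 0 <= C -> 0 <= beta -> 0 < q -> q * (1 + beta) < 2 ->
  exists2 K, 0 <= K & forall lam t, 0 < lam -> maxvar q t <= lam `^ q ->
    mom 2 0 t <= K * lam `^ (2 - q) * var q t.
Proof.
move=> wk C0 b0 q0 qb.
have q2 : q <= 2 by nra.
(* The band at scale 2^-i contributes the factor 2^(i q beta) 2^(-i (2 - q)) = th^(2 i). Halving the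
   exponent makes th also usable as the weight in [mom_filtU]. *)
pose g := (2 - q - q * beta) / 2.
have g0 : 0 < g by rewrite /g; lra.
pose th : R := 2 `^ (- g).
have th0 : 0 < th by rewrite powR_gt0.
have th1 : th < 1.
  have : 1 `^ g < (2 : R) `^ g by rewrite gt0_ltr_powR ?nnegrE ?ler0n ?ltr1n.
  by rewrite powR1 /th powRN invf_lt1 ?powR_gt0.
pose K0 := C * 2 `^ (q * beta).
have K00 : 0 <= K0 by rewrite mulr_ge0 ?powR_ge0.
exists (K0 / (1 - th) ^+ 2) => [|lam t lam0 tlam].
  by rewrite divr_ge0 ?sqr_ge0.
pose V := lam `^ (2 - q) * var q t.
have V0 : 0 <= V by rewrite mulr_ge0 ?powR_ge0 ?var_ge0.
pose S i x := `|x| <= lam / 2 ^+ i.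
pose B i x := lam / 2 ^+ i.+1 < `|x| <= lam / 2 ^+ i.
have band i : mom 2 0 (filt (B i) t) <= K0 * (th ^+ i) ^+ 2 * V.
  have p2 : (0 : R) < 2 ^+ i by rewrite exprn_gt0.
  have p21 : (1 : R) <= 2 ^+ i by rewrite exprn_ege1 // ler1n.
  have := @mom_band C beta q lam (lam / 2 ^+ i) (B i) t wk C0 b0 q0 q2.
  move=> /(_ (divr_gt0 lam0 p2)).
  rewrite ler_pdivrMr // ler_peMr ?(ltW lam0) // => /(_ isT tlam).
  have -> : 2 * lam / (lam / 2 ^+ i) = 2 * 2 ^+ i.
    by field; rewrite !gt_eqF.
  move=> h; apply: (le_trans (h _)) => [x|].
    rewrite /B exprS invfM mulrA => /andP[/ltW h1 ->]; rewrite andbT.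
    by rewrite mulrAC.
  rewrite powRM ?(ltW p2) // powRM ?invr_ge0 ?(ltW lam0) ?(ltW p2) //.
  have E : (2 ^+ i) `^ (q * beta) * (2 ^- i) `^ (2 - q) = (th ^+ i) ^+ 2 :> R.
    rewrite -powR_inv1 ?(ltW p2) // -powRrM -powRD; last by rewrite (lt0r_neq0 p2) implybT.
    rewrite -exprM /th -!powR_mulrn ?powR_ge0 // -!powRrM.
    by congr (_ `^ _); rewrite /g natrM; field.
  by rewrite /K0 /V -E le_eqVlt; apply/orP/or_introl/eqP; ring.
(* Induction upwards from a scale where nothing is left. Peeling off band i reproduces the constant:
   K0 / (1 - th) + K0 / (1 - th)^2 * th^2 / th = K0 / (1 - th)^2. *)
have main d i : (mom 2 0 (filt (S (i + d)%N) t) = 0) ->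
    mom 2 0 (filt (S i) t) <= K0 / (1 - th) ^+ 2 * (th ^+ i) ^+ 2 * V.
  elim: d i => [|d IH] i.
    rewrite addn0 => ->; apply: mulr_ge0 => //; apply: mulr_ge0; last exact: sqr_ge0.
    by apply: divr_ge0 => //; apply: sqr_ge0.
  rewrite addnS -addSn => /IH{}IH.
  have := @mom_filtU R X (B i) (S i.+1) (S i) th 0 0 t.
  rewrite th0 th1 addr0 => /(_ isT).
  have le2 : lam / 2 ^+ i.+1 <= lam / 2 ^+ i.
    by rewrite ler_pM2l // lef_pV2 ?posrE ?exprn_gt0 // ler_eXn2l ?ltr1n.
  move=> h; apply: (le_trans (h _ _)) => [x|x|].
  - rewrite /S /B; case: (leP `|x| (lam / 2 ^+ i.+1)) => h1; rewrite ?orbT ?orbF //=.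
    exact: le_trans le2.
  - by rewrite /B /S ltNge; case: (_ <= lam / 2 ^+ i.+1); rewrite ?andbF.
  have th1' : 0 < 1 - th by lra.
  apply: (le_trans (lerD (ler_wpM2r _ (band i)) (ler_wpM2r _ IH))).
  - by rewrite invr_ge0 ltW.
  - by rewrite invr_ge0 ltW.
  rewrite le_eqVlt; apply/orP/or_introl/eqP.
  by rewrite [th ^+ i.+1]exprS; field; rewrite !gt_eqF.
(* The induction starts at scale m. At scale 0 the filter is the identity, as [maxvar] bounds every
   label by lam. *)
have [m Hm] := filt_small t lam0.
have := main m 0%N; rewrite /S add0n Hm // normr0 powR0 // => /(_ erefl).
rewrite !expr0 expr1n mulr1 divr1 mulrA; congr (mom _ _ _ <= _).
apply: filt_id tlam _ => x; apply: contraTT; rewrite -!ltNge => h.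
by rewrite gt0_ltr_powR // nnegrE //; apply: ltW.
Qed.

End Weak.

(** * Real powers: subadditivity, geometric sums and a dyadic layer cake *)

Section Power.
Variable R : realType.
Implicit Types s u k m : R.

(** Each of s / (s + u) and u / (s + u) is at most 1, hence at most its k-th power. *)
Lemma powRD_le s u k : 0 <= s -> 0 <= u -> 0 < k -> k <= 1 ->
  (s + u) `^ k <= s `^ k + u `^ k.
Proof.
move=> s0 u0 k0 k1.
have [->|s1] := eqVneq s 0; first by rewrite powR0 ?gt_eqF // !add0r.
have w0 : 0 < s + u by rewrite ltr_wpDr // lt_neqAle eq_sym s1.
have frac v : 0 <= v -> v <= s + u -> v / (s + u) * (s + u) `^ k <= v `^ k.
  move=> v0 vw; have [->|v1] := eqVneq v 0; first by rewrite !mul0r powR_ge0.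
  have v0' : 0 < v by rewrite lt_neqAle eq_sym v1.
  have -> : v `^ k = (v / (s + u)) `^ k * (s + u) `^ k.
    by rewrite -powRM ?divr_ge0 ?divfK ?gt_eqF // ltW.
  rewrite ler_wpM2r ?powR_ge0 // ger1_powR // divr_gt0 //=.
  by rewrite ler_pdivrMr // mul1r.
have hs := frac s s0; have hu := frac u u0.
have -> : (s + u) `^ k = s / (s + u) * (s + u) `^ k + u / (s + u) * (s + u) `^ k.
  by rewrite -mulrDl -mulrDl divff ?gt_eqF // mul1r.
by rewrite lerD // ?hs ?hu // ?lerDl ?lerDr.
Qed.

Lemma mul_powRB1_le s m k : 0 < k -> k < 1 -> 0 <= s -> s <= m ->
  s * m `^ (k - 1) <= s `^ k.
Proof.
move=> k0 k1 s0 sm; have [->|s1] := eqVneq s 0; first by rewrite mul0r powR_ge0.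
have s0' : 0 < s by rewrite lt_neqAle eq_sym s1.
rewrite -(mulr_powRB1 s0 k0) ler_wpM2l // -opprB !powRN.
rewrite lef_pV2 ?posrE ?powR_gt0 ?(lt_le_trans s0') //.
by rewrite ge0_ler_powR ?subr_ge0 ?(ltW k1) ?nnegrE ?(le_trans s0 sm).
Qed.

(** At level m the summand is m^k up to s and s m^(k-1) beyond. Both pieces are geometric in the
    doubling of m and peak near m = s, with value about s^k. *)
Lemma sum_min_le k : 0 < k -> k < 1 -> exists2 D, 0 <= D &
  forall s m0 M, 0 <= s -> 0 < m0 ->
  \sum_(m < M) (m0 * 2 ^+ m) `^ k * (Num.min s (m0 * 2 ^+ m) / (m0 * 2 ^+ m))
    <= D * s `^ k.
Proof.
move=> k0 k1.
have one : (1 : R) `^ k = 1 /\ (1 : R) `^ (1 - k) = 1 by rewrite !powR1.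
have g1 : 1 < (2 : R) `^ k.
  by rewrite -[X in X < _](proj1 one) gt0_ltr_powR ?nnegrE ?ltr1n.
have g2 : 1 < (2 : R) `^ (1 - k).
  by rewrite -[X in X < _](proj2 one) gt0_ltr_powR ?nnegrE ?ltr1n // subr_gt0.
have g3 : (2 : R) `^ (k - 1) < 1.
  by rewrite -opprB powRN invf_lt1 ?powR_gt0.
(* Under m -> 2 m, the functions c m^k and - c' s m^(k-1) increase by m^k and s m^(k-1). *)
pose c := (2 `^ k - 1 : R)^-1; pose c' := (1 - 2 `^ (k - 1) : R)^-1.
have c0 : 0 < c by rewrite invr_gt0 subr_gt0.
have c'0 : 0 < c' by rewrite invr_gt0 subr_gt0.
have cE : c * 2 `^ k = c + 1.
  have : c * (2 `^ k - 1) = 1 by rewrite mulVf // gt_eqF ?subr_gt0.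
  by rewrite mulrBr mulr1; lra.
have c'E : c' * 2 `^ (k - 1) = c' - 1.
  have : c' * (1 - 2 `^ (k - 1)) = 1 by rewrite mulVf // gt_eqF ?subr_gt0.
  by rewrite mulrBr mulr1; lra.
exists (c + c' + 1) => [|s m0 M s0 m00]; first by lra.
(* Discrete antiderivative of the summand in [m]. *)
pose psi m := if m <= s then c * m `^ k
              else (c + c' + 1) * s `^ k - c' * (s * m `^ (k - 1)).
have sk := powR_ge0 s k.
have psi0 m : 0 < m -> 0 <= psi m.
  move=> m_gt0; rewrite /psi; case: (leP m s) => ms /=; first by rewrite mulr_ge0 ?powR_ge0 // ltW.
  have h := mul_powRB1_le k0 k1 s0 (ltW ms).
  have := ler_wpM2l (ltW c'0) h.
  by nra.
have psiD m : 0 < m -> m `^ k * (Num.min s m / m) <= psi (2 * m) - psi m.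
  move=> m_gt0; rewrite /psi.
  case: (leP (2 * m) s) => h2 /=.
    have ms : m <= s by lra.
    rewrite ms min_r // divff ?gt_eqF // mulr1 powRM ?(ltW m_gt0) //.
    by rewrite mulrA cE; lra.
  have h := mul_powRB1_le k0 k1 s0 (ltW h2).
  have {}h := ler_wpM2l (ltW c'0) h.
  case: (leP m s) => ms /=.
    (* Here m <= s < 2 m: the jump between the branches of [psi] pays for m^k, which is what the 1
       in c + c' + 1 is for. *)
    rewrite ?min_r // divff ?gt_eqF // mulr1.
    have h3 : m `^ k <= s `^ k by rewrite ge0_ler_powR ?nnegrE // ltW.
    have h4 := ler_wpM2l (ltW c0) h3.
    by lra.
  rewrite (_ : m `^ k * (s / m) = s * m `^ (k - 1)); last first.
    by rewrite -(mulr_powRB1 (ltW m_gt0) k0); field; rewrite gt_eqF.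
  rewrite powRM ?(ltW m_gt0) //.
  have -> : c' * (s * (2 `^ (k - 1) * m `^ (k - 1))) =
            (c' * 2 `^ (k - 1)) * (s * m `^ (k - 1)) by ring.
  by rewrite c'E; lra.
suff : \sum_(m < M) (m0 * 2 ^+ m) `^ k * (Num.min s (m0 * 2 ^+ m) / (m0 * 2 ^+ m))
    <= psi (m0 * 2 ^+ M).
  move=> /le_trans -> //; rewrite /psi; case: (leP (m0 * 2 ^+ M) s) => h /=.
    have hM : 0 < m0 * 2 ^+ M by rewrite mulr_gt0 ?exprn_gt0.
    have h3 : (m0 * 2 ^+ M) `^ k <= s `^ k by rewrite ge0_ler_powR ?nnegrE // ltW.
    have := ler_wpM2l (ltW c0) h3.
    by nra.
  by rewrite gerBl mulr_ge0 ?(ltW c'0) // mulr_ge0 ?powR_ge0.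
elim: M => [|M IH]; first by rewrite big_ord0 psi0 // mulr1.
have hM : 0 < m0 * 2 ^+ M by rewrite mulr_gt0 ?exprn_gt0.
rewrite big_ord_recr /= (_ : m0 * 2 ^+ M.+1 = 2 * (m0 * 2 ^+ M)); last first.
  by rewrite exprS mulrCA.
by rewrite -[leRHS](subrK (psi (m0 * 2 ^+ M))) addrC lerD ?psiD.
Qed.

(** The highest level below w is at least w / 2, so its summand alone dominates w^k; this explains
    the factor 2^k. If w is below all levels, m0^k suffices. *)
Lemma layer_cake k w m0 M : 0 < k -> 0 <= w -> 0 < m0 -> w <= m0 * 2 ^+ M ->
  w `^ k <= m0 `^ k +
    \sum_(m < M) (2 `^ k * (m0 * 2 ^+ m) `^ k) * ((m0 * 2 ^+ m < w)%R)%:R.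
Proof.
move=> k0 w0 m00; elim: M => [|M IH].
  by rewrite mulr1 big_ord0 addr0 => h; rewrite ge0_ler_powR ?nnegrE // ltW.
rewrite big_ord_recr /= => h.
have [le|gt] := leP w (m0 * 2 ^+ M); first by rewrite mulr0 addr0 IH.
rewrite mulr1 addrA ler_wpDl //.
  by rewrite addr_ge0 ?powR_ge0 // sumr_ge0 // => i _; rewrite !mulr_ge0 ?powR_ge0.
rewrite -powRM ?mulr_ge0 ?exprn_ge0 ?(ltW m00) //.
rewrite ge0_ler_powR ?(ltW k0) ?nnegrE ?mulr_ge0 ?exprn_ge0 ?(ltW m00) //.
by rewrite mulrCA -exprS.
Qed.

End Power.

(** * Path functionals, stopping and the tail estimate *)

Section Stop.
Variables (R : realType) (X : normedModType R).
Implicit Types (a x v : X) (q s : R) (t l r : tree X) (phi psi : X -> R -> R).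

(* The second argument of [phi] is the accumulated sum of [`|x| `^ q]. *)
Fixpoint ev q phi a s t : R :=
  if t is Node x l r then
    (ev q phi (a + x) (s + `|x| `^ q) l + ev q phi (a - x) (s + `|x| `^ q) r) / 2
  else phi a s.

(** [b] is the budget left for S. The norm of the next difference does not depend on its sign, so
    the cut can come before the budget is exceeded. *)
Fixpoint stop q (b : R) t : tree X :=
  if t is Node x l r then
    if `|x| `^ q <= b then
      Node x (stop q (b - `|x| `^ q) l) (stop q (b - `|x| `^ q) r)
    else @Leaf R X
  else @Leaf R X.

Lemma maxvar_stop q (b : R) t : 0 <= b -> maxvar q (stop q b t) <= b.
Proof.
elim: t b => //= x l IHl r IHr b b0; case: ifP => //= xb.
by rewrite -lerBrDl ge_max IHl ?IHr // subr_ge0.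
Qed.

Lemma ev_le q phi psi a s t :
  (forall v s', s <= s' -> phi v s' <= psi v s') ->
  ev q phi a s t <= ev q psi a s t.
Proof.
elim: t a s => [|x l IHl r IHr] a s h /=; first exact: h.
have h' v s' : s + `|x| `^ q <= s' -> phi v s' <= psi v s'.
  by move=> hs; apply: h; apply: le_trans hs; rewrite lerDl powR_ge0.
by rewrite ler_wpM2r // lerD ?IHl ?IHr.
Qed.

(** A finite tree has finitely many leaf values; thanks to [B], finitely many levels of the layer
    cake will do. *)
Lemma ev_le_bounded q a t : exists B : R, forall phi psi s,
  (forall v s', `|v| <= B -> phi v s' <= psi v s') ->
  ev q phi a s t <= ev q psi a s t.
Proof.
elim: t a => [|x l IHl r IHr] a /=; first by exists `|a| => phi psi s; apply.
have [Bl Hl] := IHl (a + x); have [Br Hr] := IHr (a - x).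
exists (Num.max Bl Br) => phi psi s h.
by rewrite ler_wpM2r // lerD ?Hl ?Hr // => v s' hv; apply: h;
   rewrite le_max hv ?orbT.
Qed.

Lemma ev_cst q (c : R) a s t : ev q (fun _ _ => c) a s t = c.
Proof. by elim: t a s => //= x l IHl r IHr a s; rewrite IHl IHr mulrDl -splitr. Qed.

Lemma evD q phi psi a s t :
  ev q (fun v s => phi v s + psi v s) a s t = ev q phi a s t + ev q psi a s t.
Proof.
by elim: t a s => //= x l IHl r IHr a s; rewrite IHl IHr -mulrDl addrACA.
Qed.

Lemma evZ q (c : R) phi a s t :
  ev q (fun v s => c * phi v s) a s t = c * ev q phi a s t.
Proof. by elim: t a s => //= x l IHl r IHr a s; rewrite IHl IHr -mulrDr mulrA. Qed.

Lemma ev_sum q M (F : nat -> X -> R -> R) a s t :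
  ev q (fun v s => \sum_(m < M) F m v s) a s t = \sum_(m < M) ev q (F m) a s t.
Proof.
elim: t a s => //= x l IHl r IHr a s.
by rewrite IHl IHr -big_split /= big_distrl.
Qed.

Lemma ev_mom q (k : R) a s t : ev q (fun v _ => `|v| `^ k) a s t = mom k a t.
Proof. by elim: t a s => //= x l IHl r IHr a s; rewrite IHl IHr. Qed.

Lemma ev_powR q k a s t : 0 < k -> k <= 1 -> 0 <= s ->
  ev q (fun _ s => s `^ k) a s t <= s `^ k + var (q * k) t.
Proof.
move=> k0 k1; elim: t a s => [|x l IHl r IHr] a s s0 /=; first by rewrite addr0.
have xs : 0 <= s + `|x| `^ q by rewrite addr_ge0 ?powR_ge0.
have := IHl (a + x) _ xs; have := IHr (a - x) _ xs.
have := powRD_le s0 (powR_ge0 `|x| q) k0 k1.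
by rewrite -powRrM; lra.
Qed.

(** On a path that is cut the full sum exceeds mu, so the minimum is mu and dominates the stopped
    sum; on the other paths both sums agree. *)
Lemma var_stop q (mu : R) a s t : s <= mu ->
  s + var q (stop q (mu - s) t) <= ev q (fun _ s => Num.min s mu) a s t.
Proof.
elim: t a s => [|x l IHl r IHr] a s smu /=; first by rewrite addr0 min_l.
have x0 := powR_ge0 `|x| q.
case: ifPn => [xmu|] /=.
  have smu' : s + `|x| `^ q <= mu by lra.
  have := IHl (a + x) _ smu'; have := IHr (a - x) _ smu'.
  by rewrite opprD addrA; lra.
rewrite -ltNge addr0 => xmu.
have big b u : mu <= ev q (fun _ s => Num.min s mu) b (s + `|x| `^ q) u.
  rewrite -{1}(ev_cst q mu b (s + `|x| `^ q) u); apply: ev_le => v s' hs.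
  by rewrite min_r //; lra.
by have := big (a + x) l; have := big (a - x) r; lra.
Qed.

(** On uncut paths this is Chebyshev's inequality for the stopped martingale; on cut paths min(S,
    mu) / mu is already 1. *)
Lemma ev_gt q (mu lam : R) a s t : 0 < lam -> mu = lam `^ q -> 0 < q ->
  0 <= s -> s <= mu ->
  ev q (fun v _ => ((mu < `|v| `^ q)%R)%:R) a s t <=
    ev q (fun _ s => Num.min s mu / mu) a s t +
    mom 2 a (stop q (mu - s) t) / lam ^+ 2.
Proof.
move=> lam0 muE q0; have mu0 : 0 < mu by rewrite muE powR_gt0.
elim: t a s => [|x l IHl r IHr] a s s0 smu /=.
  rewrite min_l // powR_mulrn //.
  have h1 : 0 <= s / mu by rewrite divr_ge0 // ltW.
  have h2 : 0 <= `|a| ^+ 2 / lam ^+ 2 by rewrite divr_ge0 ?sqr_ge0.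
  case: ltP => h /=; last by lra.
  suff : 1 <= `|a| ^+ 2 / lam ^+ 2 by lra.
  rewrite ler_pdivlMr ?exprn_gt0 // mul1r lerXn2r ?nnegrE ?(ltW lam0) //.
  rewrite leNgt; apply: contraTN h => /ltW h; rewrite -leNgt muE.
  by rewrite ge0_ler_powR ?nnegrE ?(ltW q0) ?(ltW lam0).
have x0 := powR_ge0 `|x| q.
case: ifPn => [xmu|] /=.
  have smu' : s + `|x| `^ q <= mu by lra.
  have s0' : 0 <= s + `|x| `^ q by lra.
  have := IHl (a + x) _ s0' smu'; have := IHr (a - x) _ s0' smu'.
  by rewrite opprD addrA; lra.
rewrite -ltNge => xmu.
have one b u : ev q (fun v _ => ((mu < `|v| `^ q)%R)%:R) b (s + `|x| `^ q) u <=
      ev q (fun _ s => Num.min s mu / mu) b (s + `|x| `^ q) u.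
  apply: ev_le => v s' hs.
  rewrite min_r ?divff ?gt_eqF ?lern1 ?leq_b1 //; lra.
have h2 : 0 <= `|a| `^ 2 / lam ^+ 2 by rewrite divr_ge0 ?sqr_ge0 ?powR_ge0.
by have := one (a + x) l; have := one (a - x) r; lra.
Qed.

End Stop.

(** * From the tail estimate to moments of order r *)

Section Extrapolation.
Variables (R : realType) (X : normedModType R).
Implicit Types (t : tree X).

Lemma mom_extrapolation (C beta q r : R) :
  tree_weak_type X C beta -> 0 <= C -> 0 <= beta -> 0 < r -> r < q ->
  q * (1 + beta) < 2 ->
  exists2 D, 0 <= D & forall t, mom r 0 t <= D * var r t.
Proof.
move=> wk C0 b0 r0 rq qb.
have q0 : 0 < q by apply: lt_trans rq.
have [K K0 HK] := mom_le_var wk C0 b0 q0 qb.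
pose k := r / q.
have k0 : 0 < k by rewrite divr_gt0.
have k1 : k < 1 by rewrite ltr_pdivrMr ?mul1r.
have qk : q * k = r by rewrite /k mulrC divfK ?gt_eqF.
have [D D0 HD] := sum_min_le k0 k1.
(* The factors come from [layer_cake], the tail estimate and [sum_min_le]. *)
exists (2 `^ k * (1 + K) * D) => [|t].
  by rewrite !mulr_ge0 ?powR_ge0 // addr_ge0.
have tail mu : 0 < mu ->
    ev q (fun v _ => ((mu < `|v| `^ q)%R)%:R) 0 0 t <=
    (1 + K) * ev q (fun _ s => Num.min s mu / mu) 0 0 t.
  move=> mu0; pose lam := mu `^ q^-1.
  have lam0 : 0 < lam by rewrite powR_gt0.
  have muE : mu = lam `^ q by rewrite -powRrM mulVf ?gt_eqF // powRr1 // ltW.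
  apply: le_trans (ev_gt 0 t lam0 muE q0 (lexx 0) (ltW mu0)) _.
  rewrite mulrDl mul1r lerD2l subr0 ler_pdivrMr ?exprn_gt0 //.
  have := HK lam (stop q mu t) lam0.
  rewrite -muE maxvar_stop ?(ltW mu0) // => /(_ isT) /le_trans; apply.
  have := var_stop q 0 t (ltW mu0); rewrite subr0 add0r => h.
  have -> : ev q (fun _ s => Num.min s mu / mu) 0 0 t =
            mu^-1 * ev q (fun _ s => Num.min s mu) 0 0 t.
    by rewrite -evZ; congr ev; apply/funext => v; apply/funext => s; rewrite mulrC.
  rewrite -!mulrA ler_wpM2l //.
  have -> : lam `^ (2 - q) = lam ^+ 2 / mu.
    by rewrite powRB ?(lt0r_neq0 lam0) ?implybT // -muE powR_mulrn // ltW.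
  rewrite mulrAC mulrC ler_wpM2l ?invr_ge0 ?(ltW mu0) //.
  by rewrite mulrC ler_wpM2r ?sqr_ge0.
have main m0 : 0 < m0 -> mom r 0 t <= m0 `^ k + 2 `^ k * (1 + K) * D * var r t.
  move=> m00; have [B HB] := ev_le_bounded q 0 t.
  (* Enough doublings of m0 to reach B^q, since 2^M > M. *)
  pose M := Num.bound (B `^ q / m0).
  have HM w : `|w| <= B -> `|w : X| `^ q <= m0 * 2 ^+ M.
    move=> wB; have B0 : 0 <= B by apply: le_trans wB.
    apply: (@le_trans _ _ (B `^ q)); first by rewrite ge0_ler_powR ?nnegrE // ltW.
    rewrite mulrC -ler_pdivrMr //; apply: ltW.
    have h : B `^ q / m0 < M%:R.
      by apply: archi_boundP; rewrite divr_ge0 ?powR_ge0 // ltW.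
    by apply: (lt_le_trans h); rewrite -natrX ler_nat ltnW // ltn_expl.
  pose F m (v : X) (s : R) :=
    (2 `^ k * (m0 * 2 ^+ m) `^ k) * ((m0 * 2 ^+ m < `|v| `^ q)%R)%:R.
  rewrite -(ev_mom q r 0 0).
  apply: (@le_trans _ _
    (ev q (fun v s => m0 `^ k + \sum_(m < M) F m v s) 0 0 t)).
    apply: HB => v s' /HM vM; rewrite -qk powRrM.
    by apply: layer_cake; rewrite ?powR_ge0.
  rewrite evD ev_cst lerD2l ev_sum.
  pose G m (v : X) (s : R) :=
    (m0 * 2 ^+ m) `^ k * (Num.min s (m0 * 2 ^+ m) / (m0 * 2 ^+ m)).
  apply: (@le_trans _ _ (\sum_(m < M) (2 `^ k * (1 + K)) * ev q (G m) 0 0 t)).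
    apply: ler_sum => m _; rewrite /F /G !evZ -!mulrA ler_wpM2l ?powR_ge0 //.
    rewrite mulrCA ler_wpM2l ?powR_ge0 // tail //.
    by rewrite mulr_gt0 ?exprn_gt0.
  rewrite -mulr_sumr -ev_sum -[leRHS]mulrA ler_wpM2l //.
    by rewrite mulr_ge0 ?powR_ge0 ?addr_ge0.
  apply: (@le_trans _ _ (ev q (fun _ s => D * s `^ k) 0 0 t)).
    by apply: ev_le => v s' s0; apply: HD.
  rewrite evZ ler_wpM2l //; have := ev_powR q 0 t k0 (ltW k1) (lexx 0).
  by rewrite powR0 ?gt_eqF // add0r qk.
(* The bottom level m0 was arbitrary; it is chosen so that m0^k = e. *)
apply/ler_addgt0Pr => e e0; have e0' : 0 < e `^ k^-1 by rewrite powR_gt0.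
have := main _ e0'; rewrite -powRrM mulVf ?gt_eqF // powRr1 ?(ltW e0) //.
by rewrite addrC.
Qed.

End Extrapolation.

(** * Integrals over dyadic intervals as iterated averages *)

Section Dyadic.
Local Open Scope classical_set_scope.
Variable R : realType.
Implicit Types (k i j m n : nat) (t : R) (v : nat -> R).

(** Mean of [v] over the 2^m indices starting at j 2^m, computed by halving to match the recursion
    of [mom] and [var]. *)
Fixpoint avg v m j : R :=
  if m is m'.+1 then (avg v m' j.*2 + avg v m' j.*2.+1) / 2 else v j.

(** Intervals are counted from 0 from here on, so that the halves of interval i are 2 i and 2 i +
    1. *)
Lemma dyadicP k i t : dyadic k i.+1 t <-> i%:R <= t * 2 ^+ k < i.+1%:R.
Proof.
rewrite /dyadic /= in_itv /= -[i.+1%:R]natr1 addrK.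
by rewrite ler_pdivrMr ?exprn_gt0 // ltr_pdivlMr ?exprn_gt0.
Qed.

Lemma dyadic_inj k i j t : dyadic k i.+1 t -> dyadic k j.+1 t -> i = j.
Proof.
move=> /dyadicP/andP[i1 i2] /dyadicP/andP[j1 j2].
have := le_lt_trans i1 j2; have := le_lt_trans j1 i2.
by rewrite !ltr_nat !ltnS => ji ij; apply/eqP; rewrite eqn_leq ij.
Qed.

Lemma dyadic_half k i t : dyadic k.+1 i.+1 t -> dyadic k i./2.+1 t.
Proof.
move=> /dyadicP; rewrite exprS => h; apply/dyadicP; move: h.
rewrite -[i in i%:R <= _](odd_double_half i) -[i in _ < i.+1%:R](odd_double_half i).
rewrite -!natr1 !natrD -!muln2 !natrM => /andP[h1 h2].
have o0 : 0 <= (odd i)%:R :> R by [].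
have o1 : (odd i)%:R <= 1 :> R by case: (odd i).
by apply/andP; split; nra.
Qed.

Lemma dyadicU k i :
  @dyadic R k i.+1 = @dyadic R k.+1 i.*2.+1 `|` @dyadic R k.+1 i.*2.+2.
Proof.
apply/seteqP; split => t /=; last first.
  by case=> /dyadic_half; rewrite /= ?doubleK ?uphalf_double.
move=> /dyadicP/andP[h1 h2].
have [h|h] := ltP (t * 2 ^+ k.+1) (i.*2.+1)%:R; [left|right]; apply/dyadicP.
  rewrite h andbT; move: h1; rewrite exprS -muln2 natrM; lra.
rewrite h /=; move: h2; rewrite exprS -!natr1 -muln2 natrM; lra.
Qed.

Lemma integral_dyadic v (h : R -> R) m k j : (j < 2 ^ k)%N ->
  (forall t, 0 <= h t) ->
  (forall i t, (i < 2 ^ (k + m))%N -> dyadic (k + m) i.+1 t -> h t = v i) ->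
  measurable_fun (@dyadic R k j.+1) (EFin \o h) /\
  (\int[lebesgue_measure]_(t in @dyadic R k j.+1) (h t)%:E = (avg v m j / 2 ^+ k)%:E)%E.
Proof.
move=> jk h0; elim: m k j jk => [|m IH] k j jk hv /=.
  rewrite addn0 in hv.
  split.
    apply: (eq_measurable_fun (fun=> (v j)%:E)) => [t|]; last exact: measurable_cst.
    by rewrite inE /= => /(hv _ _ jk) ->.
  rewrite (eq_integral (fun=> (v j)%:E)); last first.
    by move=> t; rewrite inE /= => /(hv _ _ jk) ->.
  rewrite integral_cst //; last exact: measurable_itv.
  rewrite EFinM; congr (_ * _)%E; apply: etrans (lebesgue_measure_itv _) _.
  rewrite /= lte_fin -[j.+1%:R]natr1 addrK.
  rewrite ltr_pM2r ?invr_gt0 ?exprn_gt0 // ltrDl ltr01 -EFinD.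
  by congr (_ %:E); rewrite -mulrBl addrAC subrr add0r mul1r.
rewrite addnS -addSn in hv.
have j1 : (j.*2 < 2 ^ k.+1)%N by rewrite expnS mul2n ltn_double.
have j2 : (j.*2.+1 < 2 ^ k.+1)%N by rewrite expnS mul2n -doubleS leq_double.
have [m1 I1] := IH _ _ j1 hv; have [m2 I2] := IH _ _ j2 hv.
have md i : measurable (@dyadic R k.+1 i) by exact: measurable_itv.
rewrite dyadicU; split; first by rewrite measurable_funU.
rewrite ge0_integral_setU //.
- rewrite I1 I2 -EFinD; congr (_ %:E).
  rewrite exprS; field; exact: lt0r_neq0 (exprn_gt0 _ _).
- exact: md.
- exact: md.
- by apply/measurable_funU; [exact: md|exact: md|].
- by move=> t _; rewrite lee_fin.
- apply/disj_setPS => t [] /= t1 t2; have := dyadic_inj t1 t2; lia.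
Qed.

Lemma Lqnorm_avg (X : normedModType R) (f : R -> X) q v n : 0 < q ->
  (forall i t, (i < 2 ^ n)%N -> dyadic n i.+1 t -> `|f t| `^ q = v i) ->
  Lqnorm q f = avg v n 0 `^ q^-1.
Proof.
move=> q0 fv; rewrite /Lqnorm.
have -> : `[0, 1[%classic = @dyadic R 0 1.
  by rewrite /dyadic expr0 !divr1 subrr.
have [_ ->] := @integral_dyadic v (fun t => `|f t| `^ q) n 0 0 isT
  (fun t => powR_ge0 _ _) fv.
by rewrite expr0 divr1.
Qed.

End Dyadic.

(** * Haar sums as trees, and trees as Haar sums *)

Section Bridge.
Variables (R : realType) (X : normedModType R).
Implicit Types (x y : nat -> nat -> X) (t : tree X) (q : R) (k i j m n : nat).

Lemma haar_halfE k j i (t : R) : dyadic k.+1 i.+1 t ->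
  haar k.+1 j.+1 t =
    if j == i./2 then (if odd i then - Num.sqrt (2 ^+ k) else Num.sqrt (2 ^+ k))
    else 0.
Proof.
move=> ti; rewrite /haar.
have -> : (2 * j.+1 - 1 = j.*2.+1)%N by lia.
have -> : (2 * j.+1 = j.*2.+2)%N by lia.
rewrite subn1 /=.
have E l : `[< dyadic k.+1 l.+1 t >] = (l == i).
  apply/asboolP/eqP => [h|->//]; exact: dyadic_inj h ti.
rewrite !E; case: (eqVneq j i./2) => [->|ji].
  rewrite -{2 4}(odd_double_half i).
  by case: (odd i); rewrite ?add0n ?add1n ?eqxx // eqn_leq ltnn andbF.
case: eqP => [h|_]; first by rewrite -h doubleK eqxx in ji.
by case: eqP => [h|//]; rewrite -h /= uphalf_double eqxx in ji.
Qed.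

(** Value of block k + 1 on the left half of interval j of level k; the right half carries its
    opposite. *)
Definition label x k j : X := Num.sqrt (2 ^+ k) *: x k.+1 j.+1.

Definition step x k i : X :=
  if odd i then - label x k i./2 else label x k i./2.

(* Value of [haar_sum x n] on the dyadic interval number [i], counted from 0. *)
Fixpoint value x n i : X :=
  if n is n'.+1 then value x n' i./2 + step x n' i else 0.

Lemma half_ltn_exp i n : (i < 2 ^ n.+1)%N -> (i./2 < 2 ^ n)%N.
Proof. by rewrite expnS; lia. Qed.

Lemma haar_block_step x k i (t : R) : (i < 2 ^ k.+1)%N -> dyadic k.+1 i.+1 t ->
  haar_block x k.+1 t = step x k i.
Proof.
move=> /half_ltn_exp ik ti; rewrite /haar_block subn1 big_add1 /= big_mkord.
rewrite (bigD1 (Ordinal ik)) //= big1 => [|j ji].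
  by rewrite addr0 (haar_halfE _ ti) eqxx /step /label; case: (odd i) => //; rewrite scaleNr.
by rewrite (haar_halfE _ ti) -(inj_eq val_inj) /= in ji *; rewrite (negbTE ji) scale0r.
Qed.

Lemma haar_sum_value x n i (t : R) : (i < 2 ^ n)%N -> dyadic n i.+1 t ->
  haar_sum x n t = value x n i.
Proof.
elim: n i => [|n IH] i ik ti; first by rewrite /haar_sum big_nil.
rewrite /haar_sum big_nat_recr //= -(IH _ (half_ltn_exp ik) (dyadic_half ti)).
by rewrite (haar_block_step _ ik ti).
Qed.

Fixpoint haar_tree x m k j : tree X :=
  if m is m'.+1 then
    Node (label x k j) (haar_tree x m' k.+1 j.*2) (haar_tree x m' k.+1 j.*2.+1)
  else @Leaf R X.

Lemma avg_value q x m k j :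
  avg (fun i => `|value x (k + m) i| `^ q) m j =
  mom q (value x k j) (haar_tree x m k j).
Proof.
elim: m k j => [|m IH] k j /=; first by rewrite addn0.
by rewrite addnS -addSn !IH /= /step /= odd_double /= doubleK uphalf_double.
Qed.

Lemma avg_step q x m k j :
  \sum_(l < m) avg (fun i => `|step x (k + l) i| `^ q) l.+1 j =
  var q (haar_tree x m k j).
Proof.
elim: m k j => [|m IH] k j /=; first by rewrite big_ord0.
rewrite big_ord_recl /= addn0 -!IH /= /step /= odd_double /= doubleK uphalf_double.
rewrite normrN [(_ + _) / 2]mulrDl -splitr -big_split /= big_distrl /=.
by congr (_ + _); apply: eq_bigr => l _; rewrite /= /bump /= addnS -addSn.
Qed.

Lemma Lqnorm_haar_sum q x n : 0 < q ->
  Lqnorm q (haar_sum x n) = mom q 0 (haar_tree x n 0 0) `^ q^-1.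
Proof.
move=> q0; rewrite (Lqnorm_avg (n := n) (v := fun i => `|value x n i| `^ q)) //.
  by rewrite -[n in value _ n]add0n avg_value.
by move=> i t ik ti; rewrite (haar_sum_value _ ik ti).
Qed.

Lemma sum_Lqnorm_haar_block q x n : 0 < q ->
  \sum_(1 <= k < n.+1) Lqnorm q (haar_block x k) `^ q =
  var q (haar_tree x n 0 0).
Proof.
move=> q0; rewrite -avg_step big_add1 /= big_mkord; apply: eq_bigr => k _.
rewrite (Lqnorm_avg (n := k.+1) (v := fun i => `|step x k i| `^ q)) //.
  rewrite -powRrM mulVf ?gt_eqF // powRr1 ?add0n //.
  have ge0 m j : 0 <= avg (fun i => `|step x k i| `^ q) m j.
    by elim: m j => [|m IH] j /=; rewrite ?powR_ge0 // divr_ge0 ?addr_ge0.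
  exact: ge0.
by move=> i t ik ti; rewrite (haar_block_step _ ik ti).
Qed.

(** The k binary digits of j, most significant first, are read as a path from the root; a path that
    leaves the tree ends in [Leaf]. *)
Fixpoint subtree t k j : tree X :=
  if k is k'.+1 then
    if subtree t k' j./2 is Node _ l r then if odd j then r else l
    else @Leaf R X
  else t.

Definition tree_coef t k j : X :=
  if subtree t k.-1 j.-1 is Node x _ _ then (Num.sqrt (2 ^+ k.-1))^-1 *: x else 0.

Lemma label_tree_coef t k j :
  label (tree_coef t) k j = if subtree t k j is Node x _ _ then x else 0.
Proof.
rewrite /label /tree_coef /=; case: (subtree t k j) => [|x l r]; first exact: scaler0.
by rewrite scalerA divff ?scale1r // gt_eqF // sqrtr_gt0 exprn_gt0.
Qed.

(** The Haar tree is the subtree padded to full height m by zero labels, which do not move the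
    martingale. *)
Lemma mom_tree_coef q t m k j a : (height (subtree t k j) <= m)%N ->
  mom q a (haar_tree (tree_coef t) m k j) = mom q a (subtree t k j).
Proof.
elim: m k j a => [|m IH] k j a h /=; first by case: subtree h.
have := IH k.+1 j.*2; have := IH k.+1 j.*2.+1.
rewrite label_tree_coef /= odd_double /= doubleK uphalf_double.
case: (subtree t k j) h => [|x l r] /= h H1 H2.
  by rewrite H1 // H2 // addr0 subr0 mulrDl -splitr.
by move: h; rewrite ltnS geq_max => /andP[h1 h2]; rewrite H1 // H2.
Qed.

(** A padded zero label contributes 0^q, which is 1 when q = 0. *)
Lemma var_tree_coef q t m k j : q != 0 -> (height (subtree t k j) <= m)%N ->
  var q (haar_tree (tree_coef t) m k j) = var q (subtree t k j).
Proof.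
move=> q0; elim: m k j => [|m IH] k j h /=; first by case: subtree h.
have := IH k.+1 j.*2; have := IH k.+1 j.*2.+1.
rewrite label_tree_coef /= odd_double /= doubleK uphalf_double.
case: (subtree t k j) h => [|x l r] /= h H1 H2.
  by rewrite H1 // H2 // normr0 powR0 // addr0 mul0r addr0.
by move: h; rewrite ltnS geq_max => /andP[h1 h2]; rewrite H1 // H2.
Qed.

(** Up to padding, a tree of height at most n comes from a Haar sum with n blocks; the inequality
    for that sum is then squared. *)
Lemma weak_haar_tree (p : R) : 0 < p -> weak_haar_type X p ->
  exists2 C, 0 <= C & tree_weak_type X C (2 / p - 1).
Proof.
move=> p0 [c [c0 Hc]]; exists (c ^+ 2) => [|n t n0 tn]; first exact: sqr_ge0.
have := Hc n (tree_coef t) n0.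
rewrite Lqnorm_haar_sum // sum_Lqnorm_haar_block //.
rewrite (@mom_tree_coef _ t n 0 0) // (@var_tree_coef _ t n 0 0) ?pnatr_eq0 //=.
set A := mom _ _ _; set B := var _ _ => h.
have A0 : 0 <= A by exact: mom_ge0.
have B0 : 0 <= B by exact: var_ge0.
have half (u : R) : 0 <= u -> (u `^ 2^-1) ^+ 2 = u.
  by move=> u0; rewrite -powR_mulrn ?powR_ge0 // -powRrM mulVf ?pnatr_eq0 // powRr1.
rewrite -(half _ A0) -(half _ B0).
have -> : n%:R `^ (2 / p - 1) = (n%:R `^ (p^-1 - 2^-1)) ^+ 2 :> R.
  rewrite -powR_mulrn ?powR_ge0 // -powRrM; congr (_ `^ _); field.
  by rewrite gt_eqF.
by rewrite -!exprMn lerXn2r ?nnegrE ?mulr_ge0 ?powR_ge0.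
Qed.

End Bridge.

(** * Conclusion for Haar sums *)

Theorem theorem1p4 (R : realType) (X : completeNormedModType R) (p : R) :
  1 <= p -> p < 2 -> weak_haar_type X p ->
  forall r : R, 1 <= r -> r < p -> haar_type X r.
Proof.
move=> p1 p2 wk r r1 rp.
have p0 : 0 < p by lra.
have r0 : 0 < r by lra.
have [C C0 HC] := weak_haar_tree p0 wk.
have b0 : 0 <= 2 / p - 1 by rewrite subr_ge0 ler_pdivlMr // mul1r ltW.
(* The intermediate exponent q is the midpoint of r and p. As 1 + beta = 2 / p, the condition q (1 +
   beta) < 2 says q < p. *)
have rq : r < (r + p) / 2 by lra.
have qb : (r + p) / 2 * (1 + (2 / p - 1)) < 2.
  by rewrite [1 + _]addrC subrK mulrCA gtr_pMr // ltr_pdivrMr // mul1r; lra.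
have [D D0 HD] := mom_extrapolation HC C0 b0 r0 rq qb.
exists (D `^ r^-1); split=> [|n x n0]; first exact: powR_ge0.
rewrite Lqnorm_haar_sum // sum_Lqnorm_haar_block // -powRM ?var_ge0 //.
rewrite ge0_ler_powR ?nnegrE ?mom_ge0 ?mulr_ge0 ?var_ge0 //.
by rewrite invr_ge0 ltW.
Qed.
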